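(* Let $\mathcal{C}$ be an idempotent-complete category, let $R,S,T$ be monads on $\mathcal{C}$, let $\lambda \colon TS \Rightarrow ST$ and $\sigma \colon SR \Rightarrow RS$ be weak distributive laws, and let $\tau \colon TR \Rightarrow RT$ be a distributive law, satisfying the Yang–Baxter equation $\sigma T \circ S\tau \circ \lambda R = R\lambda \circ \tau S \circ T\sigma$. Consider the weak distributive laws $$\phi \triangleq \pi^\sigma T \circ R\lambda \circ \tau S \circ T\iota^\sigma \colon T(R\bullet_\sigma S) \Rightarrow (R\bullet_\sigma S)T$$ and $$\psi \triangleq R\pi^\lambda \circ \sigma T \circ S\tau \circ \iota^\lambda R \colon (S\bullet_\lambda T)R \Rightarrow R(S\bullet_\lambda T).$$ Then $\phi$ and $\psi$ generate the same monad: $(R\bullet_\sigma S)\bullet_\phi T = R\bullet_\psi (S\bullet_\lambda T)$, in the sense that for any splitting of the idempotent $\kappa^\phi$ there is a splitting of $\kappa^\psi$ for which the two weak composite monads have the same underlying functor, the same unit and the same multiplication.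
   Context: $\mathcal{C}$ is idempotent complete. A monad is $(T,\eta^T,\mu^T)$. For monads $A,B$ a natural transformation $\lambda \colon BA \Rightarrow AB$ is a distributive law if it satisfies $(\eta^+)$ $\lambda \circ B\eta^A = \eta^A B$, $(\mu^+)$ $\lambda \circ B\mu^A = \mu^A B \circ A\lambda \circ \lambda A$, $(\eta^-)$ $\lambda \circ \eta^B A = A\eta^B$, $(\mu^-)$ $\lambda \circ \mu^B A = A\mu^B \circ \lambda B \circ B\lambda$; it is a weak distributive law if it satisfies $(\eta^+)$, $(\mu^+)$, $(\mu^-)$. For a weak distributive law $\lambda \colon BA \Rightarrow AB$, the natural transformation $\kappa^\lambda \triangleq A\mu^B \circ \lambda B \circ \eta^B AB \colon AB \Rightarrow AB$ is idempotent; a splitting is a functor $K$ with $\pi^\lambda \colon AB \Rightarrow K$, $\iota^\lambda \colon K \Rightarrow AB$, $\iota^\lambda \circ \pi^\lambda = \kappa^\lambda$, $\pi^\lambda \circ \iota^\lambda = 1_K$; the weak composite monad is $A\bullet_\lambda B \triangleq (K,\ \pi^\lambda \circ \eta^A\eta^B,\ \pi^\lambda \circ \mu^A\mu^B \circ A\lambda B \circ \iota^\lambda\iota^\lambda)$. Under the stated hypotheses, $\phi$ is a weak distributive law of the monad $T$ over $R\bullet_\sigma S$ and $\psi$ is a weak distributive law of $S\bullet_\lambda T$ over $R$, so both weak composites are defined. *)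

(* Defs.v *)
Set Implicit Arguments.
Unset Strict Implicit.
Unset Printing Implicit Defensive.

Declare Scope cat_scope.
Delimit Scope cat_scope with cat.
Local Open Scope cat_scope.

Record Category := {
  obj :> Type;
  hom : obj -> obj -> Type;
  idm : forall X, hom X X;
  comp : forall X Y Z, hom Y Z -> hom X Y -> hom X Z;
  compA : forall X Y Z W (h : hom Z W) (g : hom Y Z) (f : hom X Y),
    comp (comp h g) f = comp h (comp g f);
  compIf : forall X Y (f : hom X Y), comp (idm Y) f = f;
  compfI : forall X Y (f : hom X Y), comp f (idm X) = f
}.
Arguments hom {c} X Y.
Arguments idm {c} X.
Arguments comp {c X Y Z} g f : rename.
Notation "g ∘ f" := (comp g f) (at level 41, right associativity) : cat_scope.

Definition idempotent_complete (C : Category) : Prop :=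
  forall (X : C) (e : hom X X), e ∘ e = e ->
  exists (Y : C) (p : hom X Y) (i : hom Y X), i ∘ p = e /\ p ∘ i = idm Y.

(* Only endofunctors are needed. *)
Record Functor (C : Category) := {
  fobj :> C -> C;
  fmap : forall X Y, hom X Y -> hom (fobj X) (fobj Y);
  fmap_id : forall X, fmap (idm X) = idm (fobj X);
  fmap_comp : forall X Y Z (g : hom Y Z) (f : hom X Y),
    fmap (g ∘ f) = fmap g ∘ fmap f
}.
Arguments fmap {C} F {X Y} f : rename.

Definition Fid {C : Category} : Functor C := {|
  fobj := fun X => X;
  fmap := fun X Y f => f;
  fmap_id := fun X => eq_refl;
  fmap_comp := fun X Y Z g f => eq_refl
|}.

Section Fcomp.
Context {C : Category} (F G : Functor C).

Fact Fcomp_id X : fmap F (fmap G (idm X)) = idm (F (G X)).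
Proof. rewrite !fmap_id; reflexivity. Qed.

Fact Fcomp_comp X Y Z (g : hom Y Z) (f : hom X Y) :
  fmap F (fmap G (g ∘ f)) = fmap F (fmap G g) ∘ fmap F (fmap G f).
Proof. rewrite !fmap_comp; reflexivity. Qed.

Definition Fcomp : Functor C := {|
  fobj := fun X => F (G X);
  fmap := fun X Y f => fmap F (fmap G f);
  fmap_id := Fcomp_id;
  fmap_comp := Fcomp_comp
|}.

End Fcomp.
Notation "F ⊚ G" := (Fcomp F G) (at level 30, right associativity) : cat_scope.

Record NatTrans (C : Category) (F G : Functor C) := {
  component :> forall X : C, hom (F X) (G X);
  naturality : forall X Y (f : hom X Y),
    component Y ∘ fmap F f = fmap G f ∘ component X
}.
Notation "F ⇒ G" := (NatTrans F G) (at level 70) : cat_scope.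

(* Equations between natural transformations are stated componentwise; a
   whiskered transformation [F alpha G] has component [fmap F (alpha (G X))]. *)
Record Monad (C : Category) := {
  endo :> Functor C;
  eta : Fid ⇒ endo;
  mu : endo ⊚ endo ⇒ endo;
  mu_etal : forall X, mu X ∘ eta (endo X) = idm (endo X);
  mu_etar : forall X, mu X ∘ fmap endo (eta X) = idm (endo X);
  mu_assoc : forall X, mu X ∘ mu (endo X) = mu X ∘ fmap endo (mu X)
}.

Section Laws.
Context {C : Category} {A B : Monad C} (lam : B ⊚ A ⇒ A ⊚ B).

Definition law_eta_plus : Prop := forall X,
  lam X ∘ fmap B (eta A X) = eta A (B X).

Definition law_mu_plus : Prop := forall X,
  lam X ∘ fmap B (mu A X) = mu A (B X) ∘ fmap A (lam X) ∘ lam (A X).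

Definition law_eta_minus : Prop := forall X,
  lam X ∘ eta B (A X) = fmap A (eta B X).

Definition law_mu_minus : Prop := forall X,
  lam X ∘ mu B (A X) = fmap A (mu B X) ∘ lam (B X) ∘ fmap B (lam X).

End Laws.

Record WeakDistLaw (C : Category) (A B : Monad C) := {
  wdl :> B ⊚ A ⇒ A ⊚ B;
  wdl_eta_plus : law_eta_plus wdl;
  wdl_mu_plus : law_mu_plus wdl;
  wdl_mu_minus : law_mu_minus wdl
}.

Record DistLaw (C : Category) (A B : Monad C) := {
  dl :> B ⊚ A ⇒ A ⊚ B;
  dl_eta_plus : law_eta_plus dl;
  dl_mu_plus : law_mu_plus dl;
  dl_eta_minus : law_eta_minus dl;
  dl_mu_minus : law_mu_minus dl
}.

Record Splitting (C : Category) (F : Functor C) (k : F ⇒ F) := {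
  spl : Functor C;
  pi : F ⇒ spl;
  iota : spl ⇒ F;
  iota_pi : forall X, iota X ∘ pi X = k X;
  pi_iota : forall X, pi X ∘ iota X = idm (spl X)
}.

Section Rewriting.
Context {C : Category}.

Lemma re2 (X Y Z : C) (g : hom Y Z) (f : hom X Y) (h : hom X Z) :
  g ∘ f = h -> forall (W : C) (k : hom W X), g ∘ f ∘ k = h ∘ k.
Proof. intros <- W k; apply eq_sym, compA. Qed.

Lemma re3 (V X Y Z : C) (g1 : hom Z V) (g : hom Y Z) (f : hom X Y)
  (h : hom X V) :
  g1 ∘ g ∘ f = h -> forall (W : C) (k : hom W X), g1 ∘ g ∘ f ∘ k = h ∘ k.
Proof. intros <- W k; now rewrite !compA. Qed.

Lemma eta_nat (A : Monad C) (X Y : C) (f : hom X Y) :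
  eta A Y ∘ f = fmap A f ∘ eta A X.
Proof. exact (naturality (eta A) f). Qed.

Lemma mu_nat (A : Monad C) (X Y : C) (f : hom X Y) :
  mu A Y ∘ fmap A (fmap A f) = fmap A f ∘ mu A X.
Proof. exact (naturality (mu A) f). Qed.

Lemma nat22 (F G H K : Functor C) (a : F ⊚ G ⇒ H ⊚ K) (X Y : C)
  (f : hom X Y) :
  a Y ∘ fmap F (fmap G f) = fmap H (fmap K f) ∘ a X.
Proof. exact (naturality a f). Qed.

Lemma nat21 (F G H : Functor C) (a : F ⊚ G ⇒ H) (X Y : C)
  (f : hom X Y) :
  a Y ∘ fmap F (fmap G f) = fmap H f ∘ a X.
Proof. exact (naturality a f). Qed.

Lemma nat12 (F H K : Functor C) (a : F ⇒ H ⊚ K) (X Y : C)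
  (f : hom X Y) :
  a Y ∘ fmap F f = fmap H (fmap K f) ∘ a X.
Proof. exact (naturality a f). Qed.

End Rewriting.

(* Normal form: composites associated to the right, functors distributed. *)
Ltac nf := simpl; repeat first
  [rewrite fmap_comp | rewrite fmap_id | rewrite compA | rewrite compIf
  | rewrite compfI].
Ltac nf_in h := simpl in h; repeat first
  [rewrite fmap_comp in h | rewrite fmap_id in h | rewrite compA in h
  | rewrite compIf in h | rewrite compfI in h].
Ltac rw_with h := first [rewrite h | rewrite (re2 h) | rewrite (re3 h)].
(* Rewriting with an equation under zero, one or two functors. *)
Ltac rw H :=
  let h := fresh in nf; pose proof H as h; nf_in h; rw_with h; clear h; nf.
Ltac rwf F H :=
  let h := fresh in
  nf; pose proof (f_equal (fmap F) H) as h; nf_in h; rw_with h; clear h; nf.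
Ltac rwff F G H :=
  let h := fresh in
  nf; pose proof (f_equal (fun x => fmap F (fmap G x)) H) as h; nf_in h;
  rw_with h; clear h; nf.

Section Kappa.
Context {C : Category} {A B : Monad C} (lam : B ⊚ A ⇒ A ⊚ B).

Definition kappa_comp (X : C) : hom (A (B X)) (A (B X)) :=
  fmap A (mu B X) ∘ lam (B X) ∘ eta B (A (B X)).

Fact kappa_nat X Y (f : hom X Y) :
  kappa_comp Y ∘ fmap A (fmap B f) = fmap A (fmap B f) ∘ kappa_comp X.
Proof.
unfold kappa_comp; rw (eta_nat B (fmap A (fmap B f))).
rw (nat22 lam (fmap B f)); rwf A (mu_nat B f); reflexivity.
Qed.

Definition kappa : A ⊚ B ⇒ A ⊚ B :=
  @Build_NatTrans C (A ⊚ B) (A ⊚ B) kappa_comp kappa_nat.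

End Kappa.

Section HorizontalComposition.
Context {C : Category} {F F' G G' : Functor C} (a : F ⇒ F') (b : G ⇒ G').

Definition hcomp_comp (X : C) : hom (F (G X)) (F' (G' X)) :=
  fmap F' (b X) ∘ a (G X).

Fact hcomp_nat X Y (f : hom X Y) :
  hcomp_comp Y ∘ fmap F (fmap G f) = fmap F' (fmap G' f) ∘ hcomp_comp X.
Proof.
unfold hcomp_comp; rw (naturality a (fmap G f)); rwf F' (naturality b f); reflexivity.
Qed.

Definition hcomp : F ⊚ G ⇒ F' ⊚ G' :=
  @Build_NatTrans C (F ⊚ G) (F' ⊚ G') hcomp_comp hcomp_nat.

End HorizontalComposition.

Section WeakComposite.
Context {C : Category} {A B : Monad C} (lam : WeakDistLaw A B).

Definition act (X : C) : hom (B (A (B X))) (A (B X)) :=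
  fmap A (mu B X) ∘ lam (B X).

Definition mAB (X : C) : hom (A (B (A (B X)))) (A (B X)) :=
  mu A (B X) ∘ fmap A (act X).

Lemma act_nat X Y (f : hom X Y) :
  act Y ∘ fmap B (fmap A (fmap B f)) = fmap A (fmap B f) ∘ act X.
Proof.
unfold act; rw (nat22 lam (fmap B f)); rwf A (mu_nat B f); reflexivity.
Qed.

Lemma kappaE X : kappa_comp lam X = act X ∘ eta B (A (B X)).
Proof. unfold kappa_comp, act; now nf; reflexivity. Qed.

Lemma act_act X : act X ∘ fmap B (act X) = act X ∘ mu B (A (B X)).
Proof.
unfold act; rw (nat22 lam (mu B X)).
rw (wdl_mu_minus lam (B X)).
rwf A (eq_sym (mu_assoc B X)); reflexivity.
Qed.

Lemma act_mu X :
  act X ∘ fmap B (mu A (B X)) =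
  mu A (B X) ∘ fmap A (act X) ∘ lam (A (B X)).
Proof.
unfold act; rw (wdl_mu_plus lam (B X)).
rw (mu_nat A (mu B X)); reflexivity.
Qed.

Lemma act_eta X : act X ∘ fmap B (eta A (B X)) = eta A (B X) ∘ mu B X.
Proof.
unfold act; rw (wdl_eta_plus lam (B X)); rw (eta_nat A (mu B X)); reflexivity.
Qed.

Lemma actE X : act X = fmap A (mu B X) ∘ lam (B X).
Proof. reflexivity. Qed.

Lemma mABE X :
  mAB X = hcomp (mu A) (mu B) X ∘ fmap A (lam (B X)).
Proof.
unfold mAB, act; simpl; unfold hcomp_comp.
rw (mu_nat A (mu B X)); reflexivity.
Qed.

Lemma mAB_nat X Y (f : hom X Y) :
  mAB Y ∘ fmap A (fmap B (fmap A (fmap B f))) = fmap A (fmap B f) ∘ mAB X.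
Proof.
unfold mAB; rwf A (act_nat f); rw (mu_nat A (fmap B f)); reflexivity.
Qed.

Lemma kappa_act X : kappa_comp lam X ∘ act X = act X.
Proof.
rewrite kappaE; rw (eta_nat B (act X)); rw (act_act X).
rw (mu_etal B (A (B X))); reflexivity.
Qed.

Lemma kappa_idem X : kappa_comp lam X ∘ kappa_comp lam X = kappa_comp lam X.
Proof.
enough (H : kappa_comp lam X ∘ act X ∘ eta B (A (B X))
            = act X ∘ eta B (A (B X))) by now rewrite <- !kappaE in H.
now rw (kappa_act X).
Qed.

Lemma act_kappa X : act X ∘ fmap B (kappa_comp lam X) = act X.
Proof.
rewrite kappaE; rw (act_act X).
rw (mu_etar B (A (B X))); reflexivity.
Qed.

Lemma kappa_etaA X : kappa_comp lam X ∘ eta A (B X) = eta A (B X).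
Proof.
rewrite kappaE; rw (eta_nat B (eta A (B X))); rw (act_eta X).
rw (mu_etal B X); reflexivity.
Qed.

Lemma kappa_mAB X :
  kappa_comp lam X ∘ mAB X = mAB X ∘ kappa_comp lam (A (B X)).
Proof.
unfold mAB; rewrite !kappaE; rw (eta_nat B (mu A (B X))); rw (act_mu X).
rw (eta_nat B (fmap A (act X))); rw (nat22 lam (act X)).
rwf A (act_act X); rewrite (actE (A (B X))); nf; reflexivity.
Qed.

Lemma mAB_kappa X :
  mAB X ∘ fmap A (fmap B (kappa_comp lam X)) = mAB X.
Proof. unfold mAB; rwf A (act_kappa X); reflexivity. Qed.

Lemma mAB_assoc X :
  mAB X ∘ mAB (A (B X)) = mAB X ∘ fmap A (fmap B (mAB X)).
Proof.
unfold mAB; rwf A (act_mu X); rwf A (nat22 lam (act X)).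
rwff A A (act_act X); rw (eq_sym (mu_nat A (act X))).
rw (mu_assoc A (B X)).
rewrite (actE (A (B X))); nf; reflexivity.
Qed.

Context (sp : Splitting (kappa lam)).

Definition weak_unit_comp (X : C) : hom X (spl sp X) :=
  pi sp X ∘ hcomp (eta A) (eta B) X.

Definition weak_mult_comp (X : C) : hom (spl sp (spl sp X)) (spl sp X) :=
  pi sp X ∘ hcomp (mu A) (mu B) X ∘ fmap A (lam (B X))
  ∘ hcomp (iota sp) (iota sp) X.

Lemma weak_multE X :
  weak_mult_comp X =
  pi sp X ∘ mAB X ∘ fmap A (fmap B (iota sp X)) ∘ iota sp (spl sp X).
Proof. rewrite mABE; unfold weak_mult_comp; now nf. Qed.

Lemma weak_multE_re X W (k : hom W (spl sp (spl sp X))) :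
  weak_mult_comp X ∘ k =
  pi sp X ∘ mAB X ∘ fmap A (fmap B (iota sp X)) ∘ iota sp (spl sp X) ∘ k.
Proof. rewrite weak_multE; now nf. Qed.

Lemma iota_piE X : iota sp X ∘ pi sp X = kappa_comp lam X.
Proof. exact (iota_pi sp X). Qed.

Lemma kappa_iota X : kappa_comp lam X ∘ iota sp X = iota sp X.
Proof. rewrite <- iota_piE; rw (pi_iota sp X); reflexivity. Qed.

Lemma pi_kappa X : pi sp X ∘ kappa_comp lam X = pi sp X.
Proof. rewrite <- iota_piE; rw (pi_iota sp X); reflexivity. Qed.

Lemma iota_weak_mult X :
  iota sp X ∘ weak_mult_comp X =
  mAB X ∘ fmap A (fmap B (iota sp X)) ∘ iota sp (spl sp X).
Proof.
rewrite weak_multE; rw (iota_piE X); rw (kappa_mAB X).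
rw (eq_sym (naturality (iota sp) (iota sp X))).
rw (kappa_iota (A (B X))); reflexivity.
Qed.

Fact weak_unit_nat X Y (f : hom X Y) :
  weak_unit_comp Y ∘ f = fmap (spl sp) f ∘ weak_unit_comp X.
Proof.
unfold weak_unit_comp; simpl; unfold hcomp_comp.
rw (eta_nat A f); rwf A (eta_nat B f).
rw (naturality (pi sp) f); reflexivity.
Qed.

Fact weak_mult_nat X Y (f : hom X Y) :
  weak_mult_comp Y ∘ fmap (spl sp) (fmap (spl sp) f) =
  fmap (spl sp) f ∘ weak_mult_comp X.
Proof.
rewrite !weak_multE; rw (naturality (iota sp) (fmap (spl sp) f)).
rwff A B (naturality (iota sp) f); rw (mAB_nat f).
rw (naturality (pi sp) f); reflexivity.
Qed.

Definition weak_unit : Fid ⇒ spl sp :=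
  @Build_NatTrans C Fid (spl sp) weak_unit_comp weak_unit_nat.

Definition weak_mult : spl sp ⊚ spl sp ⇒ spl sp :=
  @Build_NatTrans C (spl sp ⊚ spl sp) (spl sp) weak_mult_comp weak_mult_nat.

Lemma iota_weak_unit X :
  iota sp X ∘ weak_unit_comp X = fmap A (eta B X) ∘ eta A X.
Proof.
unfold weak_unit_comp; simpl; unfold hcomp_comp; rw (iota_piE X).
rw (eq_sym (eta_nat A (eta B X))); rw (kappa_etaA X); reflexivity.
Qed.

Fact weak_mult_etal X :
  weak_mult_comp X ∘ weak_unit_comp (spl sp X) = idm (spl sp X).
Proof.
rewrite weak_multE; rw (iota_weak_unit (spl sp X)).
rw (eq_sym (eta_nat A (eta B (spl sp X)))).
rw (eq_sym (eta_nat A (fmap B (iota sp X)))).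
rw (eq_sym (eta_nat B (iota sp X))); unfold mAB.
rw (eq_sym (eta_nat A (act X))); rw (mu_etal A (B X)).
rw (eq_sym (kappaE X)); rw (pi_kappa X); exact (pi_iota sp X).
Qed.

Fact weak_mult_etar X :
  weak_mult_comp X ∘ fmap (spl sp) (weak_unit_comp X) = idm (spl sp X).
Proof.
rewrite weak_multE; rw (naturality (iota sp) (weak_unit_comp X)).
rwff A B (iota_weak_unit X); rwff A B (eq_sym (eta_nat A (eta B X))).
unfold mAB; rwf A (act_eta X); rw (mu_etar A (B X)).
rwf A (mu_etar B X); exact (pi_iota sp X).
Qed.

Fact weak_mult_assoc X :
  weak_mult_comp X ∘ weak_mult_comp (spl sp X) =
  weak_mult_comp X ∘ fmap (spl sp) (weak_mult_comp X).
Proof.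
rewrite (weak_multE_re (weak_mult_comp _)), (weak_multE_re (fmap _ _)).
rw (iota_weak_mult (spl sp X)); rw (naturality (iota sp) (weak_mult_comp X)).
rwff A B (iota_weak_mult X); rw (eq_sym (mAB_nat (iota sp X))).
rw (mAB_assoc X); reflexivity.
Qed.

Definition weak_composite : Monad C := {|
  endo := spl sp;
  eta := weak_unit;
  mu := weak_mult;
  mu_etal := weak_mult_etal;
  mu_etar := weak_mult_etar;
  mu_assoc := weak_mult_assoc
|}.

End WeakComposite.

Definition yang_baxter (C : Category) (R S T : Monad C)
  (lam : T ⊚ S ⇒ S ⊚ T) (sigma : S ⊚ R ⇒ R ⊚ S) (tau : T ⊚ R ⇒ R ⊚ T) : Prop :=
  forall X : C,
    sigma (T X) ∘ fmap S (tau X) ∘ lam (R X) =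
    fmap R (lam X) ∘ tau (S X) ∘ fmap T (sigma X).

Section IteratedLaws.
Context {C : Category} {R S T : Monad C}.
Context {lam : WeakDistLaw S T} {sigma : WeakDistLaw R S} {tau : DistLaw R T}.
Context (YB : yang_baxter lam sigma tau).

Section Phi.
Context (sp : Splitting (kappa sigma)).
Local Notation K := (weak_composite sp).

Definition phi_comp (X : C) : hom (T (K X)) (K (T X)) :=
  pi sp (T X) ∘ fmap R (lam X) ∘ tau (S X) ∘ fmap T (iota sp X).

Definition th (X : C) : hom (T (R (S X))) (R (S (T X))) :=
  fmap R (lam X) ∘ tau (S X).

Lemma th_nat X Y (f : hom X Y) :
  th Y ∘ fmap T (fmap R (fmap S f)) = fmap R (fmap S (fmap T f)) ∘ th X.
Proof.
unfold th; rw (nat22 tau (fmap S f)); rwf R (nat22 lam f); reflexivity.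
Qed.

Lemma th_kappa X :
  th X ∘ fmap T (kappa_comp sigma X) = kappa_comp sigma (T X) ∘ th X.
Proof.
unfold th, kappa_comp; rw (nat22 tau (mu S X)); rwf R (wdl_mu_plus lam X).
rw (eq_sym (YB (S X))); rw (wdl_eta_plus lam (R (S X))).
rw (eq_sym (nat22 sigma (lam X))); rw (eq_sym (eta_nat S (tau (S X)))).
rw (eq_sym (eta_nat S (fmap R (lam X)))); reflexivity.
Qed.

Lemma th_eta X :
  th X ∘ fmap T (fmap R (eta S X)) ∘ fmap T (eta R X) =
  fmap R (eta S (T X)) ∘ eta R (T X).
Proof.
unfold th; rw (nat22 tau (eta S X)); rwf R (wdl_eta_plus lam X).
rw (dl_eta_plus tau X); reflexivity.
Qed.

Lemma th_mult X :
  th X ∘ fmap T (mAB sigma X) =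
  mAB sigma (T X) ∘ fmap R (fmap S (th X)) ∘ th (R (S X)).
Proof.
unfold th, mAB, act; rw (dl_mu_plus tau (S X)).
rw (nat22 tau (fmap R (mu S X))); rw (nat22 tau (sigma (S X))).
rwf R (nat22 tau (mu S X)); rw (eq_sym (mu_nat R (lam X))).
rwff R R (wdl_mu_plus lam X); rwf R (eq_sym (YB (S X))).
rwf R (nat22 sigma (lam X)); reflexivity.
Qed.

Lemma th_muT X :
  th X ∘ mu T (R (S X)) =
  fmap R (fmap S (mu T X)) ∘ th (T X) ∘ fmap T (th X).
Proof.
unfold th; rw (dl_mu_minus tau (S X)); rwf R (wdl_mu_minus lam X).
rw (nat22 tau (lam X)); reflexivity.
Qed.

Lemma phiE X : phi_comp X = pi sp (T X) ∘ th X ∘ fmap T (iota sp X).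
Proof. unfold phi_comp, th; now nf. Qed.

Lemma iota_phi X : iota sp (T X) ∘ phi_comp X = th X ∘ fmap T (iota sp X).
Proof.
rewrite phiE; rw (iota_piE sp (T X)); rw (eq_sym (th_kappa X)).
rwf T (kappa_iota sp X); reflexivity.
Qed.

Fact phi_nat X Y (f : hom X Y) :
  phi_comp Y ∘ fmap T (fmap K f) = fmap K (fmap T f) ∘ phi_comp X.
Proof.
rewrite !phiE; rwf T (naturality (iota sp) f); rw (th_nat f).
rw (naturality (pi sp) (fmap T f)); reflexivity.
Qed.

Definition phi_nt : T ⊚ K ⇒ K ⊚ T :=
  @Build_NatTrans C (T ⊚ K) (K ⊚ T) phi_comp phi_nat.

Fact phi_eta_plus : law_eta_plus phi_nt.
Proof.
intro X; simpl; rewrite phiE; rwf T (iota_weak_unit sp X); rw (th_eta X).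
unfold weak_unit_comp; simpl; unfold hcomp_comp; reflexivity.
Qed.

Fact phi_mu_plus : law_mu_plus phi_nt.
Proof.
intro X; simpl; rewrite weak_multE_re.
rw (naturality (iota sp) (phi_comp X)); rwff R S (iota_phi X).
rw (iota_phi (spl sp X)); rw (eq_sym (th_nat (iota sp X))).
rw (eq_sym (th_mult X)); rewrite phiE; rwf T (iota_weak_mult sp X).
reflexivity.
Qed.

Fact phi_mu_minus : law_mu_minus phi_nt.
Proof.
intro X; simpl; rewrite (phiE X), (phiE (T X)).
rw (eq_sym (mu_nat T (iota sp X))); rw (th_muT X).
rw (eq_sym (naturality (pi sp) (mu T X))); rwf T (iota_piE sp (T X)).
rwf T (eq_sym (th_kappa X)); rwff T T (kappa_iota sp X); reflexivity.
Qed.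

Definition phi : WeakDistLaw K T := {|
  wdl := phi_nt;
  wdl_eta_plus := phi_eta_plus;
  wdl_mu_plus := phi_mu_plus;
  wdl_mu_minus := phi_mu_minus
|}.

End Phi.

Section Psi.
Context (sp : Splitting (kappa lam)).
Local Notation L := (weak_composite sp).

Definition psi_comp (X : C) : hom (L (R X)) (R (L X)) :=
  fmap R (pi sp X) ∘ sigma (T X) ∘ fmap S (tau X) ∘ iota sp (R X).

Definition om (X : C) : hom (S (T (R X))) (R (S (T X))) :=
  sigma (T X) ∘ fmap S (tau X).

Lemma om_nat X Y (f : hom X Y) :
  om Y ∘ fmap S (fmap T (fmap R f)) = fmap R (fmap S (fmap T f)) ∘ om X.
Proof.
unfold om; rwf S (nat22 tau f); rw (nat22 sigma (fmap T f)); reflexivity.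
Qed.

Lemma om_kappa X :
  om X ∘ kappa_comp lam (R X) = fmap R (kappa_comp lam X) ∘ om X.
Proof.
unfold om, kappa_comp; rwf S (dl_mu_minus tau X).
rw (nat22 sigma (mu T X)); rw (eq_sym (nat22 lam (tau X))).
rw (YB (T X)); rw (eq_sym (eta_nat T (fmap S (tau X)))).
rw (eq_sym (eta_nat T (sigma (T X)))); rw (dl_eta_minus tau (S (T X))).
reflexivity.
Qed.

Lemma om_eta X : om X ∘ fmap S (fmap T (eta R X)) = eta R (S (T X)).
Proof.
unfold om; rwf S (dl_eta_plus tau X); rw (wdl_eta_plus sigma (T X)).
reflexivity.
Qed.

Lemma om_muR X :
  om X ∘ fmap S (fmap T (mu R X)) =
  mu R (S (T X)) ∘ fmap R (om X) ∘ om (R X).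
Proof.
unfold om; rwf S (dl_mu_plus tau X); rw (wdl_mu_plus sigma (T X)).
rw (nat22 sigma (tau X)); reflexivity.
Qed.

Lemma om_mult X :
  om X ∘ mAB lam (R X) =
  fmap R (mAB lam X) ∘ om (S (T X)) ∘ fmap S (fmap T (om X)).
Proof.
unfold om, mAB, act; rw (eq_sym (mu_nat S (tau X))).
rw (wdl_mu_minus sigma (T X)); rwff S S (dl_mu_minus tau X).
rwf S (eq_sym (nat22 lam (tau X))); rwf S (nat22 sigma (mu T X)).
rwf S (YB (T X)); rw (nat22 sigma (fmap S (mu T X))).
rw (nat22 sigma (lam (T X))); reflexivity.
Qed.

Lemma psiE X : psi_comp X = fmap R (pi sp X) ∘ om X ∘ iota sp (R X).
Proof. unfold psi_comp, om; now nf. Qed.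

Lemma iota_psi X : fmap R (iota sp X) ∘ psi_comp X = om X ∘ iota sp (R X).
Proof.
rewrite psiE; rwf R (iota_piE sp X); rw (eq_sym (om_kappa X)).
rw (kappa_iota sp (R X)); reflexivity.
Qed.

Fact psi_nat X Y (f : hom X Y) :
  psi_comp Y ∘ fmap L (fmap R f) = fmap R (fmap L f) ∘ psi_comp X.
Proof.
rewrite !psiE; rw (naturality (iota sp) (fmap R f)); rw (om_nat f).
rwf R (naturality (pi sp) f); reflexivity.
Qed.

Definition psi_nt : L ⊚ R ⇒ R ⊚ L :=
  @Build_NatTrans C (L ⊚ R) (R ⊚ L) psi_comp psi_nat.

Fact psi_eta_plus : law_eta_plus psi_nt.
Proof.
intro X; simpl; rewrite psiE; rw (naturality (iota sp) (eta R X)).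
rw (om_eta X); rw (eq_sym (eta_nat R (pi sp X))).
rw (pi_iota sp X); reflexivity.
Qed.

Fact psi_mu_plus : law_mu_plus psi_nt.
Proof.
intro X; simpl; rewrite !psiE; rw (naturality (iota sp) (mu R X)).
rw (om_muR X); rw (eq_sym (mu_nat R (pi sp X))).
rwf R (iota_piE sp (R X)); rw (eq_sym (om_kappa (R X))).
rw (kappa_iota sp (R (R X))); reflexivity.
Qed.

Fact psi_mu_minus : law_mu_minus psi_nt.
Proof.
intro X; simpl; rewrite (weak_multE sp X); rw (iota_psi (spl sp X)).
rw (eq_sym (om_nat (iota sp X))); rw (naturality (iota sp) (psi_comp X)).
rwff S T (iota_psi X); rw (eq_sym (om_mult X)).
rewrite psiE; rw (iota_weak_mult sp (R X)); reflexivity.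
Qed.

Definition psi : WeakDistLaw R L := {|
  wdl := psi_nt;
  wdl_eta_plus := psi_eta_plus;
  wdl_mu_plus := psi_mu_plus;
  wdl_mu_minus := psi_mu_minus
|}.

End Psi.
End IteratedLaws.

(* Main.v *)
From Stdlib Require Import FunctionalExtensionality ProofIrrelevance.
Require Import Defs.
Local Open Scope cat_scope.

(** The monads [S] and [T] act on [RST] from the left, through [sigma] and
    through [lam] and [tau].  The action of [T] restricts along [iota^sigma T]
    to the one that defines [kappa^phi], and the action of [T] followed by that
    of [S] restricts along [R iota^lam] to the one that defines [kappa^psi].
    Therefore [iota^sigma T] intertwines [kappa^phi] with [R kappa^lam], and
    [R iota^lam] intertwines [kappa^psi] with [kappa^sigma T].  It follows that
    [a := R pi^lam . iota^sigma T] and [b := pi^sigma T . R iota^lam] satisfy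
    [b a = kappa^phi] and [a b = kappa^psi]: the two idempotents are isomorphic
    in the idempotent completion, so a splitting of one is carried to a
    splitting of the other on the same functor.  Since [b] respects units and
    multiplications, so does this transport. *)

Lemma NatTrans_ext (C : Category) (F G : Functor C) (a b : F ⇒ G) :
  (forall X, a X = b X) -> a = b.
Proof.
destruct a as [a na], b as [b nb]; simpl; intro ab.
assert (E : a = b) by now apply functional_extensionality_dep.
subst b; f_equal; apply proof_irrelevance.
Qed.

Lemma Monad_ext (C : Category) (F : Functor C) (e e' : Fid ⇒ F)
  (m m' : F ⊚ F ⇒ F) l l' r r' a a' :
  (forall X, e X = e' X) -> (forall X, m X = m' X) ->
  @Build_Monad C F e m l r a = @Build_Monad C F e' m' l' r' a'.
Proof.
intros ee' mm'; apply NatTrans_ext in ee'; apply NatTrans_ext in mm'.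
subst e' m'; f_equal; apply proof_irrelevance.
Qed.

Section TransferSplitting.
Context {C : Category} {F G : Functor C} {k : F ⇒ F} {l : G ⇒ G}.
Context {a : F ⇒ G} {b : G ⇒ F}.
Context (b_a : forall X, b X ∘ a X = k X) (a_b : forall X, a X ∘ b X = l X).
Context (l_idem : forall X, l X ∘ l X = l X) (sp : Splitting k).

Definition transfer_pi_comp X : hom (G X) (spl sp X) := pi sp X ∘ b X.

Definition transfer_iota_comp X : hom (spl sp X) (G X) := a X ∘ iota sp X.

Fact transfer_pi_nat X Y (f : hom X Y) :
  transfer_pi_comp Y ∘ fmap G f = fmap (spl sp) f ∘ transfer_pi_comp X.
Proof.
unfold transfer_pi_comp; rw (naturality b f); rw (naturality (pi sp) f).
reflexivity.
Qed.

Fact transfer_iota_nat X Y (f : hom X Y) :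
  transfer_iota_comp Y ∘ fmap (spl sp) f = fmap G f ∘ transfer_iota_comp X.
Proof.
unfold transfer_iota_comp; rw (naturality (iota sp) f); rw (naturality a f).
reflexivity.
Qed.

Fact transfer_iota_pi X : transfer_iota_comp X ∘ transfer_pi_comp X = l X.
Proof.
unfold transfer_iota_comp, transfer_pi_comp; rw (iota_pi sp X).
rewrite <- b_a; rw (a_b X); rw (a_b X); exact (l_idem X).
Qed.

Fact transfer_pi_iota X :
  transfer_pi_comp X ∘ transfer_iota_comp X = idm (spl sp X).
Proof.
unfold transfer_iota_comp, transfer_pi_comp; rw (b_a X).
rewrite <- iota_pi with (s := sp); rw (pi_iota sp X); exact (pi_iota sp X).
Qed.

Definition transfer_splitting : Splitting l := {|
  spl := spl sp;
  pi := {| component := transfer_pi_comp; naturality := transfer_pi_nat |};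
  iota :=
    {| component := transfer_iota_comp; naturality := transfer_iota_nat |};
  iota_pi := transfer_iota_pi;
  pi_iota := transfer_pi_iota
|}.

End TransferSplitting.

Lemma weak_composite_transfer (C : Category) (A B A' B' : Monad C)
  (lam : WeakDistLaw A B) (lam' : WeakDistLaw A' B')
  (a : A ⊚ B ⇒ A' ⊚ B') (b : A' ⊚ B' ⇒ A ⊚ B)
  (b_a : forall X, b X ∘ a X = kappa lam X)
  (a_b : forall X, a X ∘ b X = kappa lam' X)
  (b_unit : forall X,
    b X ∘ hcomp (eta A') (eta B') X = hcomp (eta A) (eta B) X)
  (b_mult : forall X,
    b X ∘ mAB lam' X = mAB lam X ∘ fmap A (fmap B (b X)) ∘ b (A' (B' X)))
  (sp : Splitting (kappa lam)) :
  weak_composite sp =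
  weak_composite (transfer_splitting b_a a_b (kappa_idem lam') sp).
Proof.
apply Monad_ext; intro X; simpl.
- unfold weak_unit_comp; rewrite <- b_unit; simpl.
  unfold transfer_pi_comp; nf; reflexivity.
- rewrite !weak_multE; simpl; unfold transfer_pi_comp, transfer_iota_comp.
  rw (b_mult X); rw (naturality b (a X)); rw (naturality b (iota sp X)).
  rw (b_a (spl sp X)); rwff A B (b_a X).
  rw (kappa_iota sp (spl sp X)); rwff A B (kappa_iota sp X); reflexivity.
Qed.

Section IteratedComposite.
Context {C : Category} {R S T : Monad C}.
Context {lam : WeakDistLaw S T} {sigma : WeakDistLaw R S} {tau : DistLaw R T}.

Definition actT X : hom (T (R (S (T X)))) (R (S (T X))) :=
  fmap R (fmap S (mu T X)) ∘ th (lam := lam) (tau := tau) (T X).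

Definition actST X : hom (S (T (R (S (T X))))) (R (S (T X))) :=
  act sigma (T X) ∘ fmap S (actT X).

Definition mRST X : hom (R (S (T (R (S (T X)))))) (R (S (T X))) :=
  mu R (S (T X)) ∘ fmap R (actST X).

Lemma actT_eta X : actT X ∘ eta T (R (S (T X))) = fmap R (kappa_comp lam X).
Proof.
unfold actT, th, kappa_comp; rw (dl_eta_minus tau (S (T X))); reflexivity.
Qed.

Lemma actST_eta X :
  actST X ∘ fmap S (eta T (R (S (T X)))) ∘ eta S (R (S (T X))) =
  kappa_comp sigma (T X) ∘ fmap R (kappa_comp lam X).
Proof.
unfold actST; rwf S (actT_eta X).
rw (eq_sym (eta_nat S (fmap R (kappa_comp lam X)))).
rw (eq_sym (kappaE sigma (T X))); reflexivity.
Qed.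

Lemma actST_omE X :
  actST X =
  fmap R (mAB lam X) ∘ om (sigma := sigma) (tau := tau) (S (T X)).
Proof.
unfold actST, actT, mAB, act, om, th.
rw (nat22 sigma (fmap S (mu T X))); rw (nat22 sigma (lam (T X))).
rwf R (mu_nat S (mu T X)); reflexivity.
Qed.

Lemma mRST_mAB X : mRST X = mAB sigma (T X) ∘ fmap R (fmap S (actT X)).
Proof. unfold mRST, actST, mAB; nf; reflexivity. Qed.

Context (YB : yang_baxter lam sigma tau).

Lemma actT_kappa X :
  actT X ∘ fmap T (kappa_comp sigma (T X)) = kappa_comp sigma (T X) ∘ actT X.
Proof.
unfold actT; rw (th_kappa YB (T X)); rw (kappa_nat sigma (mu T X)).
reflexivity.
Qed.

Context (sp_sigma : Splitting (kappa sigma)) (sp_lam : Splitting (kappa lam)).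
Local Notation RS := (weak_composite sp_sigma).
Local Notation ST := (weak_composite sp_lam).
Local Notation Phi := (phi YB sp_sigma).
Local Notation Psi := (psi YB sp_lam).

Lemma iota_act_phi X :
  iota sp_sigma (T X) ∘ act Phi X =
  actT X ∘ fmap T (iota sp_sigma (T X)).
Proof.
unfold act, actT; simpl; rw (naturality (iota sp_sigma) (mu T X)).
rw (iota_phi YB sp_sigma (T X)); reflexivity.
Qed.

Lemma iota_kappa_phi X :
  iota sp_sigma (T X) ∘ kappa_comp Phi X =
  fmap R (kappa_comp lam X) ∘ iota sp_sigma (T X).
Proof.
rewrite kappaE; rw (iota_act_phi X).
rw (eq_sym (eta_nat T (iota sp_sigma (T X)))); rw (actT_eta X); reflexivity.
Qed.

Lemma iota_mAB_phi X :
  iota sp_sigma (T X) ∘ mAB Phi X =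
  mRST X ∘ fmap R (fmap S (fmap T (iota sp_sigma (T X))))
  ∘ iota sp_sigma (T (RS (T X))).
Proof.
rewrite mRST_mAB; unfold mAB at 1; simpl.
rw (iota_weak_mult sp_sigma (T X)); rw (naturality (iota sp_sigma) (act Phi X)).
rwff R S (iota_act_phi X); reflexivity.
Qed.

Lemma iota_act_psi X :
  fmap R (iota sp_lam X) ∘ act Psi X =
  actST X ∘ fmap S (fmap T (fmap R (iota sp_lam X))) ∘ iota sp_lam (R (ST X)).
Proof.
rewrite actST_omE; unfold act; simpl; rwf R (iota_weak_mult sp_lam X).
rw (iota_psi YB sp_lam (ST X)).
rw (eq_sym (om_nat (sigma := sigma) (tau := tau) (iota sp_lam X))); reflexivity.
Qed.

Lemma iota_kappa_psi X :
  fmap R (iota sp_lam X) ∘ kappa_comp Psi X =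
  kappa_comp sigma (T X) ∘ fmap R (iota sp_lam X).
Proof.
rewrite kappaE; rw (iota_act_psi X).
rw (iota_weak_unit sp_lam (R (ST X))).
rwf S (eq_sym (eta_nat T (fmap R (iota sp_lam X)))).
rw (eq_sym (eta_nat S (fmap R (iota sp_lam X)))).
rw (actST_eta X); rwf R (kappa_iota sp_lam X); reflexivity.
Qed.

Lemma iota_mAB_psi X :
  fmap R (iota sp_lam X) ∘ mAB Psi X =
  mRST X ∘ fmap R (fmap S (fmap T (fmap R (iota sp_lam X))))
  ∘ fmap R (iota sp_lam (R (ST X))).
Proof.
unfold mRST; unfold mAB at 1; simpl; rw (eq_sym (mu_nat R (iota sp_lam X))).
rwf R (iota_act_psi X); reflexivity.
Qed.

Lemma mRST_kappa_inner X :
  mRST X ∘ fmap R (fmap S (fmap T (kappa_comp sigma (T X)))) = mRST X.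
Proof.
rewrite mRST_mAB; rwff R S (actT_kappa X); rw (mAB_kappa sigma (T X)).
reflexivity.
Qed.

Lemma pi_mRST_kappa_outer X :
  pi sp_sigma (T X) ∘ mRST X ∘ kappa_comp sigma (T (R (S (T X)))) =
  pi sp_sigma (T X) ∘ mRST X.
Proof.
rewrite mRST_mAB; rw (eq_sym (kappa_nat sigma (actT X))).
rw (eq_sym (kappa_mAB sigma (T X))); rw (pi_kappa sp_sigma (T X)); reflexivity.
Qed.

Definition assoc_lr_comp X : hom (RS (T X)) (R (ST X)) :=
  fmap R (pi sp_lam X) ∘ iota sp_sigma (T X).

Definition assoc_rl_comp X : hom (R (ST X)) (RS (T X)) :=
  pi sp_sigma (T X) ∘ fmap R (iota sp_lam X).

Fact assoc_lr_nat X Y (f : hom X Y) :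
  assoc_lr_comp Y ∘ fmap RS (fmap T f) = fmap R (fmap ST f) ∘ assoc_lr_comp X.
Proof.
unfold assoc_lr_comp; rw (naturality (iota sp_sigma) (fmap T f)).
rwf R (naturality (pi sp_lam) f); reflexivity.
Qed.

Fact assoc_rl_nat X Y (f : hom X Y) :
  assoc_rl_comp Y ∘ fmap R (fmap ST f) = fmap RS (fmap T f) ∘ assoc_rl_comp X.
Proof.
unfold assoc_rl_comp; rwf R (naturality (iota sp_lam) f).
rw (naturality (pi sp_sigma) (fmap T f)); reflexivity.
Qed.

Definition assoc_lr : RS ⊚ T ⇒ R ⊚ ST :=
  @Build_NatTrans C (RS ⊚ T) (R ⊚ ST) assoc_lr_comp assoc_lr_nat.

Definition assoc_rl : R ⊚ ST ⇒ RS ⊚ T :=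
  @Build_NatTrans C (R ⊚ ST) (RS ⊚ T) assoc_rl_comp assoc_rl_nat.

Lemma assoc_rl_lr X : assoc_rl X ∘ assoc_lr X = kappa Phi X.
Proof.
simpl; unfold assoc_rl_comp, assoc_lr_comp; rwf R (iota_piE sp_lam X).
rw (eq_sym (iota_kappa_phi X)); rw (pi_iota sp_sigma (T X)); reflexivity.
Qed.

Lemma assoc_lr_rl X : assoc_lr X ∘ assoc_rl X = kappa Psi X.
Proof.
simpl; unfold assoc_rl_comp, assoc_lr_comp; rw (iota_piE sp_sigma (T X)).
rw (eq_sym (iota_kappa_psi X)); rwf R (pi_iota sp_lam X); reflexivity.
Qed.

Lemma iota_assoc_rl X :
  iota sp_sigma (T X) ∘ assoc_rl X =
  kappa_comp sigma (T X) ∘ fmap R (iota sp_lam X).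
Proof.
simpl; unfold assoc_rl_comp; rw (iota_piE sp_sigma (T X)); reflexivity.
Qed.

Lemma assoc_rl_unit X :
  assoc_rl X ∘ hcomp (eta R) (eta ST) X = hcomp (eta RS) (eta T) X.
Proof.
simpl; unfold assoc_rl_comp, hcomp_comp; simpl.
rwf R (iota_weak_unit sp_lam X).
unfold weak_unit_comp; simpl; unfold hcomp_comp.
rw (naturality (pi sp_sigma) (eta T X)); reflexivity.
Qed.

Lemma assoc_rl_mult X :
  assoc_rl X ∘ mAB Psi X =
  mAB Phi X ∘ fmap RS (fmap T (assoc_rl X)) ∘ assoc_rl (R (ST X)).
Proof.
assert (mAB_phiE : mAB Phi X =
  pi sp_sigma (T X) ∘ mRST X ∘ fmap R (fmap S (fmap T (iota sp_sigma (T X))))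
  ∘ iota sp_sigma (T (RS (T X)))).
{ rw (eq_sym (iota_mAB_phi X)); rw (pi_iota sp_sigma (T X)); reflexivity. }
rewrite mAB_phiE; rw (naturality (iota sp_sigma) (fmap T (assoc_rl_comp X))).
rwff R S (f_equal (fmap T) (iota_assoc_rl X)); rw (mRST_kappa_inner X).
rw (iota_assoc_rl (R (ST X))).
rw (eq_sym (kappa_nat sigma (fmap T (fmap R (iota sp_lam X))))).
rw (pi_mRST_kappa_outer X).
unfold assoc_rl_comp; rw (iota_mAB_psi X); reflexivity.
Qed.

End IteratedComposite.

Theorem theorem4p6 (C : Category) (hC : idempotent_complete C)
  (R S T : Monad C)
  (lam : WeakDistLaw S T) (sigma : WeakDistLaw R S) (tau : DistLaw R T)
  (YB : yang_baxter lam sigma tau)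
  (sp_sigma : Splitting (kappa sigma)) (sp_lam : Splitting (kappa lam))
  (sp_phi : Splitting (kappa (phi YB sp_sigma))) :
  exists sp_psi : Splitting (kappa (psi YB sp_lam)),
    weak_composite sp_phi = weak_composite sp_psi.
Proof.
exists (transfer_splitting (assoc_rl_lr YB sp_sigma sp_lam)
          (assoc_lr_rl YB sp_sigma sp_lam) (kappa_idem (psi YB sp_lam)) sp_phi).
apply weak_composite_transfer.
- exact (assoc_rl_unit sp_sigma sp_lam).
- exact (assoc_rl_mult YB sp_sigma sp_lam).
Qed.
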